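(* Fix an integer $r\ge 1$. Let $Y$ be the pure random simplicial complex on vertex set $[n]$ with each $r$-dimensional simplex included independently at random with probability $p$. Then $p=\dfrac{\frac{r!}{r+1}\log n}{n^r}$ is the threshold probability for $Y$ to have a unique connected component and potentially isolated vertices. That is, if $p=\dfrac{\alpha\log n}{n^r}$ for a constant $\alpha>0$, then as $n\to\infty$: if $\alpha>\frac{r!}{r+1}$, then with probability tending to $1$ the complex $Y$ has exactly one connected component that is not an isolated vertex; and if $\alpha<\frac{r!}{r+1}$, then with probability tending to $1$ this property fails.
   Context: The pure random simplicial complex $Y$ has vertex set $[n]=\{1,\dots,n\}$ (all $n$ vertices are always present); each of the $\binom{n}{r+1}$ possible $r$-dimensional simplexes is selected independently with probability $p$, and $Y$ consists of all the vertices, all selected $r$-simplexes and all their faces. A vertex is isolated if it is contained in no selected $r$-simplex. *)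

(* Defs.v *)
From mathcomp Require Import all_boot all_order all_algebra.

Set Implicit Arguments.
Unset Strict Implicit.
Unset Printing Implicit Defensive.

Import GRing.Theory.
Local Open Scope ring_scope.

(* The vertex set [n] is 'I_n, and an r-simplex is a set of r + 1 vertices. *)
Definition r_simplices (n r : nat) : {set {set 'I_n}} :=
  [set s : {set 'I_n} | #|s| == r.+1].

(* A simplicial complex is given by the set of its nonempty faces.  S is the
   set of selected simplexes. *)
Definition pure_complex (n : nat) (S : {set {set 'I_n}}) : {set {set 'I_n}} :=
  [set s : {set 'I_n} |
    (#|s| == 1)%N || ((s != set0) && [exists t in S, s \subset t])].

Definition vertices (n : nat) (K : {set {set 'I_n}}) : {set 'I_n} :=
  [set v | [set v] \in K].

(* For u = v this says that v is a vertex of K: a harmless loop. *)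
Definition adjacent (n : nat) (K : {set {set 'I_n}}) : rel 'I_n :=
  [rel u v | [set u; v] \in K].

(* Vertex sets of the connected components: two vertices are in the same
   component when they are joined by a path of edges (1-faces) of K. *)
Definition components (n : nat) (K : {set {set 'I_n}}) : {set {set 'I_n}} :=
  equivalence_partition (connect (adjacent K)) (vertices K).

Definition isolated (n : nat) (S : {set {set 'I_n}}) (v : 'I_n) : bool :=
  [forall s in S, v \notin s].

Definition unique_nonisolated_component (n : nat) (S : {set {set 'I_n}}) :
    bool :=
  #|[set C in components (pure_complex S) |
      ~~ [exists v, isolated S v && (C == [set v])]]| == 1%N.

(* Probability of the event A when every r-simplex is selected independently
   with probability p: the sample space is the set of all S \subset
   r_simplices n r, with the product of Bernoulli(p) weights. *)
Definition Pr (R : pzRingType) (n r : nat) (p : R)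
    (A : pred {set {set 'I_n}}) : R :=
  \sum_(S : {set {set 'I_n}} | (S \subset r_simplices n r) && A S)
    \prod_(s in r_simplices n r) (if s \in S then p else 1 - p).

(* Main.v *)
Require Import Defs.
From mathcomp Require Import all_boot all_order all_algebra.
From mathcomp Require Import ring lra zify.
Import Order.TTheory GRing.Theory Num.Theory.

(** Let q = 1 - p, and write k for the size of a vertex set C.

    Supercritical case: if the complex has some simplex but not exactly one
    non-isolated component, then some component C with 2k <= n is not crossed
    by any selected simplex and contains at least k / (r + 1) selected ones,
    since these cover C.  No connectivity of C is needed.  For mu >= 1, the
    exponential moment of the number of selected simplexes inside C bounds the
    probability of this event by
      mu^-k (1 + p (mu^(r+1) - 1))^C(k,r+1) q^(k C(n-k,r)).
    With mu^(r+1) = eta (n/k)^r for k <= eps n and mu = 1 for larger k, and with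
    C(n,k) <= (e n/k)^k, the union bound is dominated by the geometric series
    of ratio O(n^-g) for some g > 0, because alpha / r! > 1 / (r + 1).

    Subcritical case: a selected simplex that meets no other selected simplex
    is a component.  The mean m of the number of these tends to infinity like a
    positive power of n, and for two disjoint simplexes the events are
    correlated by a factor at most q^(-B) with p B -> 0, since only
    O(n^(r-1)) simplexes meet both.  By the second moment method there are at
    least two of them with probability tending to 1. *)

Local Open Scope ring_scope.

(** * Random subsets *)

Definition expect {R : realFieldType} {T : finType} (U : {set T}) (p : R)
    (f : {set T} -> R) : R :=
  \sum_(S : {set T} | S \subset U)
    (\prod_(s in U) (if s \in S then p else 1 - p)) * f S.

(** Independence of the selections. Expanding the product of sums means choosing one summand for
    each element, and [S] records the choices. *)
Lemma expect_prod (R : realFieldType) (T : finType) (U : {set T}) (p : R)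
    (x y : T -> R) :
  expect U p (fun S => \prod_(s in U) (if s \in S then x s else y s)) =
  \prod_(s in U) (p * x s + (1 - p) * y s).
Proof.
(* Outside [U] the summands 0 and 1 cancel every [S] not contained in [U]. *)
pose F s := if s \in U then p * x s else 0.
pose G s := if s \in U then (1 - p) * y s else 1.
have -> : \prod_(s in U) (p * x s + (1 - p) * y s) = \prod_s (F s + G s).
  rewrite big_mkcond; apply: eq_bigr => s _; rewrite /F /G.
  by case: ifP => // _; rewrite add0r.
rewrite bigA_distr /expect big_mkcond; apply: eq_bigr => S _.
case: ifPn => [SU|/subsetPn[s sS sU]]; last first.
  by rewrite (bigD1 s) //= sS /F (negPf sU) mul0r.
rewrite -big_split /= [LHS]big_mkcond; apply: eq_bigr => s _; rewrite /F /G.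
by have := subsetP SU s; case: (s \in S); case: (s \in U) => //= /(_ isT).
Qed.

Lemma expectD (R : realFieldType) (T : finType) (U : {set T}) (p : R)
    (f g : {set T} -> R) :
  expect U p (fun S => f S + g S) = expect U p f + expect U p g.
Proof. by rewrite -big_split; apply: eq_bigr => S _; rewrite mulrDr. Qed.

Lemma expectZ (R : realFieldType) (T : finType) (U : {set T}) (p c : R)
    (f : {set T} -> R) :
  expect U p (fun S => c * f S) = c * expect U p f.
Proof. by rewrite mulr_sumr; apply: eq_bigr => S _; rewrite mulrCA. Qed.

Lemma expect_sum (R : realFieldType) (T I : finType) (U : {set T}) (p : R)
    (P : pred I) (f : I -> {set T} -> R) :
  expect U p (fun S => \sum_(i | P i) f i S) = \sum_(i | P i) expect U p (f i).
Proof.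
by rewrite exchange_big; apply: eq_bigr => S _; rewrite mulr_sumr.
Qed.

Lemma expect_cst (R : realFieldType) (T : finType) (U : {set T}) (p c : R) :
  expect U p (fun=> c) = c.
Proof.
have /= e1 := expect_prod R T U p (fun=> 1) (fun=> 1).
transitivity (expect U p (fun S => c * 1)).
  by apply: eq_bigr => S _; rewrite mulr1.
rewrite expectZ -[RHS]mulr1; congr (_ * _).
transitivity (\prod_(s in U) (p * 1 + (1 - p) * 1)).
  rewrite -e1; apply: eq_bigr => S _; congr (_ * _).
  by rewrite big1 // => s _; case: ifP.
by rewrite big1 // => s _; rewrite !mulr1 addrC subrK.
Qed.

Lemma eq_expect (R : realFieldType) (T : finType) (U : {set T}) (p : R)
    (f g : {set T} -> R) :
  (forall S : {set T}, S \subset U -> f S = g S) -> expect U p f = expect U p g.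
Proof. by move=> fg; apply: eq_bigr => S SU; rewrite fg. Qed.

Lemma le_expect (R : realFieldType) (T : finType) (U : {set T}) (p : R)
    (f g : {set T} -> R) : 0 <= p <= 1 ->
  (forall S : {set T}, S \subset U -> f S <= g S) -> expect U p f <= expect U p g.
Proof.
move=> /andP[p0 p1] fg; apply: ler_sum => S SU; apply: ler_wpM2l (fg _ SU).
by apply: prodr_ge0 => s _; case: ifP; rewrite ?subr_ge0.
Qed.

Lemma expect_ge0 (R : realFieldType) (T : finType) (U : {set T}) (p : R)
    (f : {set T} -> R) : 0 <= p <= 1 ->
  (forall S : {set T}, S \subset U -> 0 <= f S) -> 0 <= expect U p f.
Proof.
move=> p01 f0; rewrite -(expect_cst R T U p 0); exact: le_expect.
Qed.

Lemma prod_if_const (R : realFieldType) (T : finType) (U : {set T})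
    (P : pred T) (c : R) :
  \prod_(s in U) (if P s then c else 1) = c ^+ #|[set s in U | P s]|.
Proof.
rewrite -big_mkcondr -prodr_const; apply: eq_bigl => s; by rewrite inE.
Qed.

(** Chebyshev's inequality for the number of indices in [J] whose event holds, at distance m - 1
    below its mean m. In the second moment the diagonal gives m, since indicators are idempotent,
    and the other pairs give at most m^2 / b. *)
Lemma le_second_moment (R : realFieldType) (T I : finType) (U : {set T})
    (p b : R) (J : {set I}) (A : I -> pred {set T})
    (m := \sum_(i in J) expect U p (fun S => (A i S)%:R)) :
  0 <= p <= 1 -> 0 < b -> 1 <= m ->
  {in J &, forall i j, i != j ->
    b * expect U p (fun S => (A i S && A j S)%:R) <=
    expect U p (fun S => (A i S)%:R) * expect U p (fun S => (A j S)%:R)} ->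
  expect U p (fun S => (#|[set i in J | A i S]| <= 1)%:R) * (m - 1) ^+ 2 <=
    m + (b^-1 - 1) * m ^+ 2.
Proof.
move=> p01 b0 m1 cor.
pose X S : R := \sum_(i in J) (A i S)%:R.
have XE S : X S = #|[set i in J | A i S]|%:R.
  rewrite /X -natr_sum -sum1_card; congr (_%:R).
  under [RHS]eq_bigl do rewrite inE.
  by rewrite big_mkcondr; apply: eq_bigr => i _; case: (A i S).
have EX : expect U p X = m by rewrite /X expect_sum.
have EXX : expect U p (fun S => X S ^+ 2) <= m + b^-1 * m ^+ 2.
  have -> : expect U p (fun S => X S ^+ 2) =
      \sum_(i in J) \sum_(j in J) expect U p (fun S => (A i S && A j S)%:R).
    transitivity (expect U p (fun S =>
        \sum_(i in J) \sum_(j in J) (A i S && A j S)%:R)).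
      apply: eq_expect => S _; rewrite expr2 /X mulr_suml; apply: eq_bigr => i _.
      by rewrite mulr_sumr; apply: eq_bigr => j _; rewrite mulrb; case: (A i S); rewrite ?mul0r ?mul1r.
    by rewrite expect_sum; apply: eq_bigr => i _; rewrite expect_sum.
  rewrite {1}/m expr2 {1}/m mulr_suml mulr_sumr -big_split /=.
  apply: ler_sum => i iJ; rewrite (bigD1 i) //=; apply: lerD.
    by under eq_expect do rewrite andbb.
  rewrite /m mulr_sumr mulr_sumr.
  (* The term j = i, absent on the left, is nonnegative. *)
  rewrite [leRHS](bigD1 i) //= -[leLHS]add0r; apply: lerD.
    have E0 : 0 <= expect U p (fun S => (A i S)%:R).
      by apply: expect_ge0 => // S _; rewrite ler0n.
    by rewrite mulr_ge0 ?invr_ge0 ?(ltW b0) // mulr_ge0.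
  apply: ler_sum => j /andP[jJ ji]; rewrite ler_pdivlMl //.
  by apply: cor; rewrite // eq_sym.
(* Where X <= 1 <= m, the square (X - m)^2 is at least (m - 1)^2. *)
apply: (@le_trans _ _ (expect U p (fun S => (X S - m) ^+ 2))).
  rewrite mulrC -expectZ; apply: le_expect => // S _.
  case: leqP => c1; last by rewrite mulr0 sqr_ge0.
  have : X S <= 1 by rewrite XE lern1.
  by rewrite mulr1; nra.
have -> : expect U p (fun S => (X S - m) ^+ 2) =
    expect U p (fun S => X S ^+ 2) - m ^+ 2.
  transitivity (expect U p (fun S => X S ^+ 2 + (- (m *+ 2) * X S + m ^+ 2))).
    by apply: eq_expect => S _; ring.
  by rewrite !expectD expectZ expect_cst EX; ring.
by lra.
Qed.

(** * Components of a pure complex *)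

Lemma PrE (R : realFieldType) (n r : nat) (p : R) (A : pred {set {set 'I_n}}) :
  Pr r p A = expect (r_simplices n r) p (fun S => (A S)%:R).
Proof.
rewrite /Pr big_mkcondr; apply: eq_bigr => S _.
by case: (A S); rewrite ?mulr1 ?mulr0.
Qed.

Lemma PrC (R : realFieldType) (n r : nat) (p : R) (A : pred {set {set 'I_n}}) :
  Pr r p A = 1 - Pr r p (fun S => ~~ A S).
Proof.
rewrite !PrE; apply/eqP; rewrite eq_sym subr_eq -expectD eq_sym; apply/eqP.
rewrite -[RHS](expect_cst _ _ (r_simplices n r) p).
by apply: eq_expect => S _; case: (A S); rewrite ?addr0 ?add0r.
Qed.

Lemma card_r_simplices (n r : nat) : #|r_simplices n r| = 'C(n, r.+1).
Proof. by rewrite card_draws card_ord. Qed.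

Lemma adjacentE (n : nat) (S : {set {set 'I_n}}) (u v : 'I_n) :
  adjacent (pure_complex S) u v =
  (u == v) || [exists t in S, (u \in t) && (v \in t)].
Proof.
rewrite /adjacent /= inE cards2 eqSS eqb0 negbK; case: (u == v) => //=.
have -> : [set u; v] != set0 by apply/set0Pn; exists u; rewrite !inE eqxx.
by apply: eq_existsb => t; rewrite subUset !sub1set.
Qed.

Lemma adjacent_sym (n : nat) (K : {set {set 'I_n}}) : symmetric (adjacent K).
Proof. by move=> u v; rewrite /adjacent /= setUC. Qed.

Lemma vertices_pure_complex (n : nat) (S : {set {set 'I_n}}) :
  vertices (pure_complex S) = setT.
Proof. by apply/setP => v; rewrite !inE cards1. Qed.

Lemma components_partition (n : nat) (S : {set {set 'I_n}}) :
  partition (components (pure_complex S)) setT.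
Proof.
rewrite /components vertices_pure_complex; apply: equivalence_partitionP.
have sym := sym_connect_sym (adjacent_sym _ (pure_complex S)).
move=> x y z _ _ _; split=> [|xy]; first exact: connect0.
by apply: same_connect.
Qed.

Lemma component_connect (n : nat) (S : {set {set 'I_n}}) (C : {set 'I_n})
    (u v : 'I_n) :
  C \in components (pure_complex S) -> u \in C ->
  (v \in C) = connect (adjacent (pure_complex S)) u v.
Proof.
have sym := sym_connect_sym (adjacent_sym _ (pure_complex S)).
rewrite /components vertices_pure_complex => /imsetP[x _ ->].
by rewrite !inE /= => xu; apply: same_connect.
Qed.

Lemma component_mem (n : nat) (S : {set {set 'I_n}}) (u : 'I_n) :
  [set v | connect (adjacent (pure_complex S)) u v]
    \in components (pure_complex S).
Proof.
rewrite /components vertices_pure_complex; apply/imsetP; exists u => //.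
by apply/setP => v; rewrite !inE.
Qed.

(** Adjacency cannot leave [A], so neither can a path. This is used with [A] the singleton of an
    isolated vertex and with [A] an isolated simplex. *)
Lemma connect_stable (n : nat) (S : {set {set 'I_n}}) (A : {set 'I_n})
    (u v : 'I_n) :
  (forall t, t \in S -> ~~ [disjoint t & A] -> t \subset A) ->
  u \in A -> connect (adjacent (pure_complex S)) u v -> v \in A.
Proof.
move=> clA uA uv; rewrite -(closed_connect _ uv) //.
apply: intro_closed; first exact/sym_connect_sym/adjacent_sym.
move=> x y; rewrite adjacentE => /orP[/eqP <- //|].
move=> /exists_inP[t tS /andP[xt yt]] xA.
apply: (subsetP (clA t tS _)) yt.
by rewrite -setI_eq0; apply/set0Pn; exists x; rewrite inE xt.
Qed.

(** * Non-isolated components and detached sets *)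

Definition nonisolated_components (n : nat) (S : {set {set 'I_n}}) :=
  [set C in components (pure_complex S) |
      ~~ [exists v, isolated S v && (C == [set v])]].

Definition crossing (n : nat) (C s : {set 'I_n}) : bool :=
  ~~ (s \subset C) && ~~ [disjoint s & C].

(* Every non-isolated component is detached; connectivity is given up, and
   covering is weakened to its consequence for cardinals. *)
Definition detached (n r : nat) (C : {set 'I_n}) (S : {set {set 'I_n}}) : bool :=
  [forall s in S, ~~ crossing n C s] &&
  (#|C| <= r.+1 * #|[set s in S | s \subset C]|)%N.

(** The vertices of a selected simplex are pairwise adjacent, so it cannot cross a component. Every
    vertex of [C] lies in a selected simplex, which is then inside [C]; sets of r + 1 vertices thus
    cover [C]. *)
Lemma nonisolated_covered (n r : nat) (S : {set {set 'I_n}}) (C : {set 'I_n}) :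
  S \subset r_simplices n r -> C \in nonisolated_components n S ->
  detached n r C S.
Proof.
move=> SU; rewrite inE => /andP[CP niC].
have noX : [forall s in S, ~~ crossing n C s].
  apply/forall_inP => s sS; apply/negP => /andP[/subsetPn[v vs vC]].
  rewrite -setI_eq0 => /set0Pn[u]; rewrite inE => /andP[us uC].
  move: vC; rewrite (component_connect _ _ _ _ v CP uC) connect1 // adjacentE.
  by apply/orP; right; apply/exists_inP; exists s => //; rewrite us vs.
rewrite /detached noX /=; set SC := [set _ in _ | _].
have : C \subset cover SC.
  apply/subsetP => v vC; have [/forall_inP iv|] := boolP (isolated S v).
    (* If v is isolated, no path leaves {v}, so [C] is {v}, which is excluded. *)
    case/existsP: niC; exists v; apply/andP; split; first exact/forall_inP.
    apply/eqP/setP => w; rewrite (component_connect _ _ _ _ w CP vC) !inE.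
    apply/idP/eqP => [vw|-> //]; apply/set1P; apply: (connect_stable _ _ _ _ _ _ _ vw).
      move=> t tS; rewrite -setI_eq0 => /set0Pn[x].
      by rewrite !inE => /andP[xt /eqP xv]; have := iv t tS; rewrite -xv xt.
    by rewrite inE.
  rewrite negb_forall_in => /exists_inP[s sS]; rewrite negbK => vs.
  apply/bigcupP; exists s => //; rewrite inE sS /=.
  have := forall_inP noX s sS; rewrite negb_and !negbK => /orP[] //.
  by move/disjointFr => /(_ _ vs); rewrite vC.
move/subset_leq_card/leq_trans; apply.
apply: leq_trans (leq_card_cover _) _.
rewrite mulnC -sum_nat_const leq_sum // => s; rewrite inE => /andP[sS _].
by have := subsetP SU s sS; rewrite inE => /eqP ->.
Qed.

(** A selected simplex yields one non-isolated component, so failure of uniqueness gives two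
    disjoint ones, and the smaller has at most n / 2 vertices. *)
Lemma not_unique_detached (n r : nat) (S : {set {set 'I_n}}) :
  S \subset r_simplices n r -> S != set0 ->
  ~~ unique_nonisolated_component S ->
  exists C : {set 'I_n},
    [/\ C != set0, (2 * #|C| <= n)%N & detached n r C S].
Proof.
move=> SU /set0Pn[s sS]; have := subsetP SU s sS; rewrite inE => /eqP cs.
have /card_gt0P[v vs] : (0 < #|s|)%N by rewrite cs.
rewrite /unique_nonisolated_component -/(nonisolated_components n S) => nu.
have F0 : (0 < #|nonisolated_components n S|)%N.
  apply/card_gt0P.
  exists [set w | connect (adjacent (pure_complex S)) v w].
  rewrite inE component_mem /=; apply/existsP => -[w /andP[/forall_inP iw /eqP e]].
  have : v \in [set w] by rewrite -e inE connect0.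
  by rewrite inE => /eqP vw; have := iw s sS; rewrite -vw vs.
have {nu F0} /card_gt1P[C [D [CF DF CD]]] :
  (1 < #|nonisolated_components n S|)%N by rewrite ltn_neqAle eq_sym nu.
have /and3P[_ /trivIsetP tI P0] := components_partition n S.
have dj : [disjoint C & D].
  by apply: tI CD; [move: CF|move: DF]; rewrite inE => /andP[].
have sz : (#|C| + #|D| <= n)%N.
  rewrite -cardsUI; move: dj; rewrite -setI_eq0 => /eqP ->.
  by rewrite cards0 addn0 (leq_trans (max_card _)) ?card_ord.
have nz A : A \in nonisolated_components n S -> A != set0.
  by rewrite inE => /andP[AP _]; apply: contraNneq P0 => <-.
have [le|lt] := leqP #|C| #|D|.
  by exists C; split; [exact: nz| lia |exact: nonisolated_covered].
by exists D; split; [exact: nz| lia |exact: nonisolated_covered].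
Qed.

(** * Isolated simplexes *)

Definition isolated_simplex (n : nat) (s : {set 'I_n}) (S : {set {set 'I_n}}) :
    bool :=
  (s \in S) && [forall t in S, (t != s) ==> [disjoint t & s]].

(** No other selected simplex meets [s], so by [connect_stable] a path from a vertex of [s] stays in
    [s]. *)
Lemma isolated_simplex_component (n r : nat) (S : {set {set 'I_n}})
    (s : {set 'I_n}) :
  S \subset r_simplices n r -> isolated_simplex n s S ->
  s \in nonisolated_components n S.
Proof.
move=> SU /andP[sS /forall_inP hs].
have := subsetP SU s sS; rewrite inE => /eqP cs.
have /card_gt0P[v vs] : (0 < #|s|)%N by rewrite cs.
rewrite inE; apply/andP; split; last first.
  apply/existsP => -[w /andP[/forall_inP iw /eqP e]].
  by have := iw s sS; rewrite e set11.
suff -> : s = [set w | connect (adjacent (pure_complex S)) v w].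
  exact: component_mem.
apply/setP => w; rewrite inE; apply/idP/idP => [ws|]; last first.
  move=> vw; apply: (connect_stable _ _ _ _ _ _ vs vw) => t tS ts.
  by have := hs t tS; rewrite (negPf ts) implybF negbK => /eqP ->.
apply: connect1; rewrite adjacentE; apply/orP; right.
by apply/exists_inP; exists s => //; rewrite vs ws.
Qed.

Lemma unique_isolated_simplices (n r : nat) (S : {set {set 'I_n}}) :
  S \subset r_simplices n r -> unique_nonisolated_component S ->
  (#|[set s in r_simplices n r | isolated_simplex n s S]| <= 1)%N.
Proof.
move=> SU /eqP e; rewrite -[leqRHS]e; apply: subset_leq_card.
apply/subsetP => s.
by rewrite inE => /andP[_]; apply: (isolated_simplex_component _ _ _ _ SU).
Qed.

(** * Counting crossing and meeting simplexes *)

(** Only the simplexes with exactly one vertex in [C] are counted: join a vertex of [C] to r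
    vertices outside. They do cross because r > 0. *)
Lemma card_crossing (n r : nat) (C : {set 'I_n}) : (0 < r)%N ->
  (#|C| * 'C(n - #|C|, r) <=
   #|[set s in r_simplices n r | crossing n C s]|)%N.
Proof.
move=> r0; pose D := [set w : {set 'I_n} | (w \subset ~: C) & (#|w| == r)].
have -> : 'C(n - #|C|, r) = #|D|.
  by rewrite /D cards_draws [#|~: C|]cardsCs setCK card_ord.
rewrite -cardsX; pose f (x : 'I_n * {set 'I_n}) := x.1 |: x.2.
(* Both components of [x] are recovered from their union, as its parts inside and outside [C]; hence
   [f] is injective. *)
have fC x : x \in setX C D -> f x :&: C = [set x.1] /\ f x :\: C = x.2.
  rewrite !inE => /and3P[xC]; rewrite subsets_disjoint setCK => dj _.
  have nC y : y \in x.2 -> y \in C = false by move=> /(disjointFr dj).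
  have x12 : x.1 \in x.2 = false by apply/negP => /nC; rewrite xC.
  split; apply/setP => y; rewrite !inE; case: eqVneq => [->|_] /=.
  - by rewrite xC.
  - by case: (boolP (y \in x.2)) => // /nC ->.
  - by rewrite xC x12.
  - by case: (boolP (y \in x.2)) => [/nC -> //|_]; rewrite andbF.
have fi : {in setX C D &, injective f}.
  move=> x y /fC[x1 x2] /fC[y1 y2] fxy; move: x1 x2; rewrite fxy y1 y2.
  by case: x {fxy} y {y1 y2} => [a b] [c d] /= /set1_inj -> ->.
rewrite -(card_in_imset fi); apply: subset_leq_card.
apply/subsetP => _ /imsetP[x xD ->]; have [e1 e2] := fC x xD.
move: xD; rewrite !inE => /and3P[xC xs /eqP cx].
have x12 : x.1 \notin x.2.
  by apply/negP => /(subsetP xs); rewrite inE xC.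
rewrite cardsU1 x12 cx eqxx /= /crossing -setI_eq0 e1 -setD_eq0 e2.
rewrite -!card_gt0 cards1 cx r0 //.
Qed.

Definition meeting (n r : nat) (s : {set 'I_n}) : {set {set 'I_n}} :=
  [set t in r_simplices n r | (t != s) && ~~ [disjoint t & s]].

Lemma r_simplices_pick (n r : nat) (s t : {set 'I_n}) :
  t \in r_simplices n r -> ~~ [disjoint t & s] ->
  exists x (w : {set 'I_n}), [/\ x \in s, x \notin w, #|w| = r & t = x |: w].
Proof.
rewrite inE => /eqP ct; rewrite -setI_eq0 => /set0Pn[x]; rewrite inE => /andP[xt xs].
exists x, (t :\ x); split; rewrite ?setD1K ?setD11 //.
by move: ct; rewrite (cardsD1 x) xt => -[].
Qed.

(** Such a simplex is a vertex of [s] joined to r further vertices; repetitions only help the upper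
    bound. *)
Lemma card_meeting (n r : nat) (s : {set 'I_n}) : s \in r_simplices n r ->
  (#|meeting n r s| <= r.+1 * 'C(n, r))%N.
Proof.
rewrite inE => /eqP cs; rewrite -{1}cs -[n in 'C(n, _)]card_ord -card_draws.
rewrite -cardsX; apply: leq_trans (leq_imset_card (fun x => x.1 |: x.2) _).
apply: subset_leq_card; apply/subsetP => t; rewrite inE => /and3P[tU _ ts].
have [x [w [xs _ cw ->]]] := r_simplices_pick _ _ _ _ tU ts.
by apply/imsetP; exists (x, w) => //; rewrite !inE /= xs cw eqxx.
Qed.

(** A vertex in [s] and one in [t] are distinct by disjointness, which leaves r - 1 free
    vertices. *)
Lemma card_meetingI (n r : nat) (s t : {set 'I_n}) : (0 < r)%N ->
  s \in r_simplices n r -> t \in r_simplices n r -> [disjoint s & t] ->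
  (#|meeting n r s :&: meeting n r t| <= r.+1 ^ 2 * 'C(n, r.-1))%N.
Proof.
case: r => // r _; rewrite inE => /eqP cs; rewrite inE => /eqP ct dj.
rewrite -mulnn -{1}cs -{1}ct -[n in 'C(n, _)]card_ord -card_draws -!cardsX.
apply: leq_trans (leq_imset_card (fun x => x.1.1 |: (x.1.2 |: x.2)) _).
apply: subset_leq_card; apply/subsetP => w; rewrite inE => /andP[].
rewrite inE => /and3P[wU _ ws]; rewrite inE => /and3P[_ _ wt].
have [x [w' [xs _ cw' e]]] := r_simplices_pick _ _ _ _ wU ws.
(* The dimension is now [r.+1], so removing a vertex leaves an r-simplex. The removed x is in s,
   hence not in t, so the rest still meets t and can be decomposed again. *)
have w'U : w' \in r_simplices n r by rewrite inE cw'.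
have w't : ~~ [disjoint w' & t].
  move: wt; rewrite e -!setI_eq0 setIUl setU_eq0 negb_and => /orP[|//].
  by rewrite setI_eq0 disjoints1 (disjointFr dj xs).
have [y [w2 [yt _ cw2 e2]]] := r_simplices_pick _ _ _ _ w'U w't.
by apply/imsetP; exists (x, y, w2); rewrite ?e ?e2 // !inE /= xs yt cw2 eqxx.
Qed.

(** * Bounds for fixed n *)

(** The indicator is dominated by mu^-|C| times a product of weights of the selected simplexes: 0 if
    crossing, mu^(r+1) if inside [C], 1 otherwise. By independence the expectation of that product
    factorizes. *)
Lemma expect_detached_le (R : realFieldType) (n r : nat) (p mu : R)
    (C : {set 'I_n}) : (0 < r)%N -> 0 <= p <= 1 -> 1 <= mu ->
  expect (r_simplices n r) p (fun S => (detached n r C S)%:R) <=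
  mu^-1 ^+ #|C| * ((1 + p * (mu ^+ r.+1 - 1)) ^+ 'C(#|C|, r.+1) *
                   (1 - p) ^+ (#|C| * 'C(n - #|C|, r))).
Proof.
move=> r0 p01 mu1; have /andP[p0 p1] := p01.
have mu0 : 0 < mu by apply: lt_le_trans mu1.
pose x s : R := if crossing n C s then 0 else
                if s \subset C then mu ^+ r.+1 else 1.
have x0 s : 0 <= x s.
  by rewrite /x; case: ifP => // _; case: ifP => // _; rewrite exprn_ge0 // ltW.
apply: (@le_trans _ _ (expect (r_simplices n r) p (fun S =>
    mu^-1 ^+ #|C| *
    \prod_(s in r_simplices n r) (if s \in S then x s else 1)))).
  (* Markov: the covering condition gives 1 <= mu^((r+1) X - #|C|), where X is
     the number of selected simplexes inside C. *)
  apply: le_expect => // S SU; case: (boolP (detached n r C S)); last first.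
    move=> _; rewrite mulr_ge0 ?exprn_ge0 ?invr_ge0 ?(ltW mu0) //.
    by apply: prodr_ge0 => s _; case: ifP.
  move=> /andP[/forall_inP nX cov].
  have -> : \prod_(s in r_simplices n r) (if s \in S then x s else 1) =
      mu ^+ (r.+1 * #|[set s in S | s \subset C]|).
    rewrite exprM -prod_if_const -big_mkcondr; apply: congr_big => // s.
      case: (boolP (s \in S)) => sS; last by rewrite andbF.
      by rewrite (subsetP SU).
    by move=> /andP[_ sS]; rewrite /x (negPf (nX s sS)).
  rewrite -(subnKC cov) exprD mulrA -exprMn mulVf ?gt_eqF // expr1n mul1r.
  exact: exprn_ege1.
rewrite expectZ ler_wpM2l ?exprn_ge0 ?invr_ge0 ?(ltW mu0) // expect_prod.
apply: (@le_trans _ _ (\prod_(s in r_simplices n r)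
   ((if s \subset C then 1 + p * (mu ^+ r.+1 - 1) else 1) *
    (if crossing n C s then 1 - p else 1)))).
  have mun0 : 0 <= mu ^+ r.+1 by rewrite exprn_ge0 ?(ltW mu0).
  apply: ler_prod => s _; apply/andP; split.
    by rewrite mulr1 addr_ge0 ?mulr_ge0 ?subr_ge0.
  rewrite /x /crossing; case: (s \subset C) => /=.
    by rewrite !mulr1; lra.
  by case: ifP => _; lra.
rewrite big_split /= !prod_if_const; apply: ler_pM.
- by rewrite exprn_ge0 // addr_ge0 ?mulr_ge0 ?subr_ge0 // exprn_ege1.
- by rewrite exprn_ge0 // subr_ge0.
- rewrite le_eqVlt -cards_draws; apply/orP; left; apply/eqP.
  by congr (_ ^+ _); apply: eq_card => s; rewrite !inE andbC.
- by apply: ler_wiXn2l; rewrite ?subr_ge0 ?gerBl //; apply: card_crossing.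
Qed.

Lemma sum_card (R : realFieldType) (n : nat) (P : pred nat)
    (f : nat -> R) :
  \sum_(A : {set 'I_n} | P #|A|) f #|A| =
  \sum_(k < n.+1 | P k) 'C(n, k)%:R * f k.
Proof.
have cA (A : {set 'I_n}) : (#|A| < n.+1)%N.
  by rewrite ltnS -[leqRHS]card_ord max_card.
rewrite (partition_big (fun A : {set 'I_n} => Ordinal (cA A)) P) //=.
apply: eq_bigr => k Pk; rewrite -[X in 'C(X, _)]card_ord -card_draws mulr_natl -sumr_const.
apply: eq_big => [A|A /andP[_ /eqP <-] //].
rewrite !inE -val_eqE /=; case: eqP => [->|]; by rewrite ?Pk ?andbF.
Qed.

(** Union bound: either nothing is selected or some set of at most n / 2 vertices is detached. The
    parameter [mu] may vary with the size of the set. *)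
Lemma Pr_not_unique_le (R : realFieldType) (n r : nat) (p : R)
    (mu : nat -> R) : (0 < r)%N -> 0 <= p <= 1 -> (forall k, (0 < k)%N -> 1 <= mu k) ->
  Pr r p (fun S : {set {set 'I_n}} => ~~ unique_nonisolated_component S) <=
  (1 - p) ^+ 'C(n, r.+1) +
  \sum_(k < n.+1 | (0 < k)%N && (2 * k <= n)%N)
    'C(n, k)%:R * ((mu k)^-1 ^+ k * ((1 + p * (mu k ^+ r.+1 - 1)) ^+ 'C(k, r.+1) *
                   (1 - p) ^+ (k * 'C(n - k, r)))).
Proof.
move=> r0 p01 mu1; rewrite PrE.
apply: (@le_trans _ _ (expect (r_simplices n r) p (fun S =>
   (* This product is the indicator that no simplex is selected. *)
   \prod_(s in r_simplices n r) (if s \in S then 0 else 1) +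
   \sum_(C : {set 'I_n} | (0 < #|C|)%N && (2 * #|C| <= n)%N)
     (detached n r C S)%:R))).
  apply: le_expect => // S SU.
  have p0 : 0 <= \prod_(s in r_simplices n r) (if s \in S then 0 else 1) :> R.
    by apply: prodr_ge0 => s _; case: ifP.
  have s0 (P : pred {set 'I_n}) : 0 <= \sum_(C | P C) (detached n r C S)%:R :> R.
    by apply: sumr_ge0 => C _; rewrite ler0n.
  case: (boolP (unique_nonisolated_component S)) => /= [_|nu].
    by rewrite addr_ge0.
  have [S0|SN] := eqVneq S set0.
    by rewrite big1 ?lerDl ?s0 // => s _; rewrite S0 inE.
  have [C [C0 Cn sC]] := not_unique_detached _ _ _ SU SN nu.
  rewrite [X in _ + X](bigD1 C) /=; last by rewrite card_gt0 C0.
  by rewrite sC addrCA lerDl addr_ge0.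
rewrite expectD; apply: lerD.
  rewrite expect_prod -card_r_simplices -prodr_const.
  by apply: ler_prod => s _; move/andP: p01 => [? ?]; apply/andP; split; lra.
pose P k := (0 < k)%N && (2 * k <= n)%N.
rewrite expect_sum -(sum_card R n P (fun k => (mu k)^-1 ^+ k *
  ((1 + p * (mu k ^+ r.+1 - 1)) ^+ 'C(k, r.+1) * (1 - p) ^+ (k * 'C(n - k, r))))).
apply: ler_sum => C /andP[C0 _]; apply: expect_detached_le => //; exact: mu1.
Qed.

(** * Moments of the number of isolated simplexes *)

(** One factor per simplex, the form that [expect_prod] requires: a selected simplex must not meet
    [s], and an unselected one must differ from [s]. *)
Lemma isolated_simplexE (R : realFieldType) (n r : nat)
    (s : {set 'I_n}) (S : {set {set 'I_n}}) :
  s \in r_simplices n r -> S \subset r_simplices n r ->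
  (isolated_simplex n s S)%:R =
  \prod_(t in r_simplices n r)
    (if t \in S then (t \notin meeting n r s)%:R else (t != s)%:R) :> R.
Proof.
move=> sU SU; case: (boolP (isolated_simplex n s S)) => [/andP[sS /forall_inP hs]|].
  rewrite big1 // => t _; case: ifPn => [tS|].
    rewrite inE (subsetP SU _ tS) /=.
    by have := hs t tS; case: (t == s); case: [disjoint t & s].
  by have [->|//] := eqVneq t s; rewrite sS.
rewrite negb_and negb_forall_in => /orP[sS|/exists_inP[t tS]].
  by rewrite (bigD1 s) //= (negPf sS) eqxx mul0r.
rewrite negb_imply => ht; rewrite (bigD1 t) ?(subsetP SU) //= tS.
by rewrite inE (subsetP SU _ tS) ht mul0r.
Qed.

Lemma notin_meeting (n r : nat) (s : {set 'I_n}) : s \notin meeting n r s.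
Proof. by rewrite inE eqxx andbF. Qed.

Lemma prod_pred1 (R : realFieldType) (T : finType) (U : {set T}) (s : T) (c : R) :
  s \in U -> \prod_(t in U) (if t == s then c else 1) = c.
Proof.
move=> sU; rewrite (bigD1 s) //= eqxx big1 ?mulr1 //.
by move=> t /andP[_ /negPf ->].
Qed.

Lemma meeting_sub (n r : nat) (s : {set 'I_n}) :
  meeting n r s \subset r_simplices n r.
Proof. by apply/subsetP => t; rewrite inE => /andP[]. Qed.

Lemma expect_isolated (R : realFieldType) (n r : nat) (p : R)
    (s : {set 'I_n}) : s \in r_simplices n r ->
  expect (r_simplices n r) p (fun S => (isolated_simplex n s S)%:R) =
  p * (1 - p) ^+ #|meeting n r s|.
Proof.
move=> sU; pose y (t : {set 'I_n}) : R := (t != s)%:R.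
transitivity (expect (r_simplices n r) p (fun S => \prod_(t in r_simplices n r)
    (if t \in S then (t \notin meeting n r s)%:R else y t))).
  by apply: eq_expect => S SU; apply: isolated_simplexE.
rewrite expect_prod.
transitivity (\prod_(t in r_simplices n r) ((if t == s then p else 1) *
    (if t \in meeting n r s then 1 - p else 1))).
  apply: eq_bigr => t _; rewrite /y; case: eqVneq => [->|_].
    by rewrite (negPf (notin_meeting _ _ _)) /=; ring.
  by case: ifP => _ /=; ring.
rewrite big_split /= prod_pred1 // prod_if_const; congr (_ * _ ^+ _).
by apply: eq_card => t; rewrite inE andb_idl // => /(subsetP (meeting_sub _ _ _)).
Qed.

(** Distinct simplexes that intersect are never both isolated. For disjoint ones the joint
    probability is p^2 q^|A :|: B|, with A and B the two [meeting] sets, and |A| + |B| exceeds |A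
    :|: B| by |A :&: B|, which [card_meetingI] bounds. *)
Lemma expect_isolated_pair (R : realFieldType) (n r : nat) (p : R)
    (s t : {set 'I_n}) : (0 < r)%N -> 0 <= p <= 1 ->
  s \in r_simplices n r -> t \in r_simplices n r -> s != t ->
  (1 - p) ^+ (r.+1 ^ 2 * 'C(n, r.-1)) *
    expect (r_simplices n r) p
      (fun S => (isolated_simplex n s S && isolated_simplex n t S)%:R) <=
  expect (r_simplices n r) p (fun S => (isolated_simplex n s S)%:R) *
  expect (r_simplices n r) p (fun S => (isolated_simplex n t S)%:R).
Proof.
move=> r0 p01 sU tU st; have /andP[p0 p1] := p01.
have q0 : 0 <= 1 - p by rewrite subr_ge0.
have q1 : 1 - p <= 1 by rewrite gerBl.
rewrite !expect_isolated //.
have [dj|ndj] := boolP [disjoint s & t]; last first.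
  have -> : expect (r_simplices n r) p (fun S : {set {set 'I_n}} =>
      (isolated_simplex n s S && isolated_simplex n t S)%:R) = 0.
    rewrite -(expect_cst R _ (r_simplices n r) p 0); apply: eq_expect => S _.
    case: (boolP (_ && _)) => // /andP[/andP[sS _] /andP[tS /forall_inP ht]].
    by have := ht s sS; rewrite st (negPf ndj).
  by rewrite mulr0 !mulr_ge0 ?exprn_ge0.
pose x (w : {set 'I_n}) : R :=
  (w \notin meeting n r s)%:R * (w \notin meeting n r t)%:R.
pose y (w : {set 'I_n}) : R := (w != s)%:R * (w != t)%:R.
have -> : expect (r_simplices n r) p (fun S : {set {set 'I_n}} =>
      (isolated_simplex n s S && isolated_simplex n t S)%:R) =
    p * p * (1 - p) ^+ #|meeting n r s :|: meeting n r t|.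
  transitivity (expect (r_simplices n r) p (fun S => \prod_(w in r_simplices n r)
      (if w \in S then x w else y w))).
    apply: eq_expect => S SU.
    rewrite -mulnb natrM (isolated_simplexE _ _ r) //.
    rewrite (isolated_simplexE _ _ r _ _ tU) // -big_split /=.
    by apply: eq_bigr => w _; case: ifP.
  rewrite expect_prod.
  transitivity (\prod_(w in r_simplices n r)
      (((if w == s then p else 1) * (if w == t then p else 1)) *
      (if w \in meeting n r s :|: meeting n r t then 1 - p else 1))).
    apply: eq_bigr => w _; rewrite /x /y [in RHS]inE.
    (* By disjointness s does not lie in the [meeting] set of t, so its factor is exactly p;
       likewise for t. *)
    have [->|ws] := eqVneq w s.
      rewrite (negPf (notin_meeting _ _ _)) (negPf st) /= inE dj !andbF /=.
      by ring.
    have [->|wt] := eqVneq w t.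
      rewrite (negPf (notin_meeting _ _ _)) /= inE disjoint_sym dj !andbF /=.
      by ring.
    by case: (w \in meeting n r s); case: (w \in meeting n r t) => /=; ring.
  rewrite !big_split /= !prod_pred1 // prod_if_const; congr (_ * _ ^+ _).
  apply: eq_card => w; rewrite inE andb_idl // => /setUP[].
    exact: subsetP (meeting_sub _ _ _) _.
  exact: subsetP (meeting_sub _ _ _) _.
rewrite mulrCA [leRHS]mulrACA -!exprD ler_wpM2l ?mulr_ge0 //.
apply: ler_wiXn2l => //; rewrite -cardsUI addnC leq_add2r.
exact: card_meetingI.
Qed.

(* m is the expected number of isolated simplexes. *)
Lemma Pr_unique_le (R : realFieldType) (n r : nat) (p : R)
    (m := \sum_(s in r_simplices n r) p * (1 - p) ^+ #|meeting n r s|)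
    (b := (1 - p) ^+ (r.+1 ^ 2 * 'C(n, r.-1))) :
  (0 < r)%N -> 0 <= p -> p < 1 -> 1 <= m ->
  Pr r p (fun S : {set {set 'I_n}} => unique_nonisolated_component S) *
    (m - 1) ^+ 2 <= m + (b^-1 - 1) * m ^+ 2.
Proof.
move=> r0 p0 p1 m1; have p01 : 0 <= p <= 1 by rewrite p0 ltW.
have mE : m = \sum_(s in r_simplices n r)
    expect (r_simplices n r) p (fun S => (isolated_simplex n s S)%:R).
  by apply: eq_bigr => s sU; rewrite expect_isolated.
rewrite mE in m1 *.
have b0 : 0 < b by rewrite exprn_gt0 // subr_gt0.
apply: le_trans (le_second_moment _ _ _ _ _ _ _ _ p01 b0 m1 _).
  rewrite ler_wpM2r ?sqr_ge0 // PrE; apply: le_expect => // S SU.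
  case: (boolP (unique_nonisolated_component S)) => [u|_]; last exact: ler0n.
  by rewrite (unique_isolated_simplices _ _ _ SU u).
by move=> s t sU tU st; apply: expect_isolated_pair.
Qed.

(** * Elementary estimates *)

(* Imported only here, since classical_sets shadows names of finset such as
   subsetP. *)
From mathcomp Require Import all_classical all_reals all_analysis.
Import Order.TTheory GRing.Theory Num.Theory.
Import numFieldNormedType.Exports.

Lemma bin_fact_le (R : realFieldType) (n k : nat) :
  'C(n, k)%:R * k`!%:R <= n%:R ^+ k :> R.
Proof.
rewrite -natrM -natrX ler_nat bin_ffact ffact_prod.
rewrite -[k in (n ^ k)%N]card_ord -prod_nat_const.
by apply: leq_prod => i _; apply: leq_subr.
Qed.

Lemma bin_le_exp (R : realFieldType) (n k : nat) :
  'C(n, k)%:R <= n%:R ^+ k :> R.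
Proof.
apply: le_trans (bin_fact_le _ n k).
by rewrite ler_peMr ?ler0n // ler1n fact_gt0.
Qed.

(** Each factor n - i of the falling factorial is at least n - k >= y. *)
Lemma exp_le_bin_fact (R : realFieldType) (y : R) (n k : nat) :
  0 <= y -> y + k%:R <= n%:R -> y ^+ k <= 'C(n, k)%:R * k`!%:R.
Proof.
move=> y0 yk; rewrite -natrM bin_ffact ffact_prod natr_prod.
rewrite -[k in y ^+ k]card_ord -prodr_const; apply: ler_prod => i _.
rewrite y0 /=; have ik : (i%:R : R) <= k%:R by rewrite ler_nat ltnW.
rewrite natrB; first by lra.
by rewrite -(ler_nat R); lra.
Qed.

Lemma expn_le_expR_fact (R : realType) (k : nat) :
  k%:R ^+ k <= expR k%:R * k`!%:R :> R.
Proof.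
elim: k => [|k IH]; first by rewrite expr0 expR0 fact0 mulr1.
(* (1 + 1/k)^k <= e *)
have step : (k.+1)%:R ^+ k <= expR 1 * k%:R ^+ k :> R.
  case: k {IH} => [|k]; first by rewrite !expr0 mulr1 -expR0 ler_expR.
  have k0 : 0 < k.+1%:R :> R by rewrite ltr0n.
  have -> : k.+2%:R = (1 + k.+1%:R^-1) * k.+1%:R :> R.
    by rewrite mulrDl mulVf ?gt_eqF // mul1r -natr1 addrC.
  rewrite exprMn ler_wpM2r ?exprn_ge0 ?ler0n //.
  have -> : expR 1 = expR (k.+1%:R^-1) ^+ k.+1 :> R.
    by rewrite -expRM_natl mulfV ?gt_eqF.
  by rewrite lerXn2r ?nnegrE ?expR_ge0 ?expR_ge1Dx // addr_ge0 // invr_ge0 ltW.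
rewrite factS natrM exprS -natr1 expRD natr1.
have := mulr_ge0 (ler0n R k.+1) (expR_ge0 (1 : R)).
have k0 := ler0n R k.+1.
move=> e0; apply: le_trans (ler_wpM2l k0 step) _.
rewrite [leRHS](_ : _ = k.+1%:R * expR 1 * (expR k%:R * k`!%:R)); last by ring.
by rewrite [leLHS]mulrA ler_wpM2l.
Qed.

(** This is C(n,k) <= (e n/k)^k, in exponential form so that exponents can be added. *)
Lemma bin_le_expR (R : realType) (n k : nat) : (0 < k)%N -> (0 < n)%N ->
  'C(n, k)%:R <= expR (k%:R * (1 + ln n%:R - ln k%:R)) :> R.
Proof.
move=> k0 n0; have k0R : 0 < k%:R :> R by rewrite ltr0n.
have n0R : 0 < n%:R :> R by rewrite ltr0n.
have f0 : 0 < k`!%:R :> R by rewrite ltr0n fact_gt0.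
rewrite expRM_natl expRD expRN expRD !lnK ?posrE // !exprMn exprVn.
rewrite ler_pdivlMr ?exprn_gt0 // -expRM_natl mulr1.
apply: le_trans (ler_wpM2l _ (expn_le_expR_fact R k)) _; rewrite ?ler0n //.
by rewrite mulrCA ler_wpM2l ?expR_ge0 // bin_fact_le.
Qed.

Lemma onem_exp_le (R : realType) (p : R) (m : nat) : p <= 1 ->
  (1 - p) ^+ m <= expR (- (m%:R * p)).
Proof.
move=> p1; rewrite -mulrN expRM_natl lerXn2r ?nnegrE ?expR_ge0 ?subr_ge0 //.
exact: expR_ge1Dx.
Qed.

(** 1 / (1 - p) = 1 + p / (1 - p) <= exp (p c). *)
Lemma le_onem_exp (R : realType) (p c : R) (m : nat) : 0 <= p -> p < 1 ->
  (1 - p)^-1 <= c -> expR (- (m%:R * (p * c))) <= (1 - p) ^+ m.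
Proof.
move=> p0 p1 pc; have q0 : 0 < 1 - p by rewrite subr_gt0.
rewrite -mulrN expRM_natl lerXn2r ?nnegrE ?expR_ge0 ?(ltW q0) //.
rewrite expRN invf_ple ?posrE ?expR_gt0 //.
have -> : (1 - p)^-1 = 1 + p * (1 - p)^-1 by field; lra.
apply: le_trans (expR_ge1Dx _) _.
by rewrite ler_expR ler_wpM2l.
Qed.

Lemma sum_exp_le (R : realFieldType) (n : nat) (P : pred nat) (x : R) :
  0 <= x -> x <= 2^-1 -> \sum_(k < n.+1 | (0 < k)%N && P k) x ^+ k <= 2 * x.
Proof.
move=> x0 x1.
have g m : (1 - x) * (\sum_(k < m) x ^+ k) = 1 - x ^+ m.
  elim: m => [|m IH]; first by rewrite big_ord0 expr0; ring.
  by rewrite big_ord_recr /= mulrDr IH exprS; ring.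
have -> : 2 * x = x * 2 by rewrite mulrC.
apply: (@le_trans _ _ (x * \sum_(k < n) x ^+ k)).
  rewrite big_mkcond big_ord_recl /= add0r mulr_sumr; apply: ler_sum => k _.
  by rewrite /bump /= add1n -exprS; case: ifP => // _; rewrite exprn_ge0.
apply: ler_wpM2l => //; have := g n; have := exprn_ge0 n x0.
set s := \sum_(_ < _) _; have : 0 <= s by apply: sumr_ge0 => k _; rewrite exprn_ge0.
nra.
Qed.

Lemma near_le_ln (R : realType) (M : R) :
  \forall n \near \oo%classic, M <= ln (n%:R : R).
Proof.
near=> n; have h : expR M <= n%:R.
  by near: n; exact: nbhs_infty_ger.
by rewrite -(expRK M) ler_ln ?posrE ?expR_gt0 // (lt_le_trans _ h) ?expR_gt0.
Unshelve. all: by end_near.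
Qed.

(** With s = e / 2, ln (s n) <= s n - 1 bounds ln n by s n - ln s, and the constant - ln s is
    eventually below s n. *)
Lemma near_ln_le (R : realType) (e : R) : 0 < e ->
  \forall n \near \oo%classic, ln (n%:R : R) <= e * n%:R.
Proof.
move=> e0; pose s := e / 2; have s0 : 0 < s by rewrite divr_gt0.
near=> n; have h : - ln s / s <= n%:R.
  by near: n; exact: nbhs_infty_ger.
have n0 : 0 < (n%:R : R).
  by rewrite (lt_le_trans ltr01) //; near: n; exact: nbhs_infty_ger.
have hh : -1 < s * n%:R - 1 by have := mulr_gt0 s0 n0; lra.
have := le_ln1Dx hh; rewrite addrCA subrr addr0 lnM ?posrE //.
move: h; rewrite ler_pdivrMr // => h hl.
have -> : e = s + s by rewrite /s; field.
by rewrite mulrDl; lra.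
Unshelve. all: by end_near.
Qed.

(** * Asymptotics *)

(** Put mu = exp t and apply 1 + x <= exp x to both powers. *)
Lemma detached_term_le (R : realType) (n k N M d : nat) (p t : R) :
  0 <= p <= 1 -> 0 <= t -> (0 < k)%N -> (0 < n)%N ->
  'C(n, k)%:R * ((expR t)^-1 ^+ k *
    ((1 + p * (expR t ^+ d - 1)) ^+ N * (1 - p) ^+ M)) <=
  expR (k%:R * (1 + ln n%:R - ln k%:R - t) +
        N%:R * p * (expR (d%:R * t) - 1) - M%:R * p).
Proof.
move=> /andP[p0 p1] t0 k0 n0.
have e1 : 1 <= expR t ^+ d by rewrite exprn_ege1 // -expR0 ler_expR.
have -> : k%:R * (1 + ln n%:R - ln k%:R - t) + N%:R * p * (expR (d%:R * t) - 1) -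
    M%:R * p = k%:R * (1 + ln n%:R - ln k%:R) + (k%:R * - t +
    (N%:R * (p * (expR t ^+ d - 1)) + - (M%:R * p))).
  by rewrite -expRM_natl; ring.
have q0 : 0 <= 1 - p by rewrite subr_ge0.
have f0 : 0 <= 1 + p * (expR t ^+ d - 1).
  by rewrite addr_ge0 // mulr_ge0 // subr_ge0.
rewrite expRD; apply: ler_pM; first exact: ler0n.
- by rewrite !mulr_ge0 ?exprn_ge0 ?invr_ge0 ?expR_ge0.
- exact: bin_le_expR.
rewrite expRD expRM_natl expRN ler_wpM2l ?exprn_ge0 ?invr_ge0 ?expR_ge0 //.
rewrite expRD; apply: ler_pM; rewrite ?exprn_ge0 //; last exact: onem_exp_le.
by rewrite expRM_natl lerXn2r ?nnegrE ?expR_ge0 // expR_ge1Dx.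
Qed.

(** The hypothesis keeps the r factors of the falling factorial of n - k above c n. *)
Lemma crossing_weight_ge (R : realType) (n k r : nat) (alpha c : R) :
  0 < alpha -> 0 <= c -> (0 < n)%N -> c * n%:R + r%:R + k%:R <= n%:R ->
  k%:R * (ln n%:R * (alpha * c ^+ r / r`!%:R)) <=
  (k * 'C(n - k, r))%:R * (alpha * ln n%:R / n%:R ^+ r).
Proof.
move=> a0 c0 n0 hc; have n0R : 0 < n%:R :> R by rewrite ltr0n.
have f0 : 0 < r`!%:R :> R by rewrite ltr0n fact_gt0.
have L0 : 0 <= ln n%:R :> R by rewrite ln_ge0 // ler1n.
have cn : 0 <= c * n%:R by rewrite mulr_ge0 // ltW.
have kn : (k <= n)%N by rewrite -(ler_nat R); have := ler0n R r; lra.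
have h : (c * n%:R) ^+ r <= 'C(n - k, r)%:R * r`!%:R.
  by apply: exp_le_bin_fact; rewrite // natrB //; lra.
have nr0 : 0 < n%:R ^+ r :> R by rewrite exprn_gt0.
rewrite natrM -[leRHS]mulrA ler_wpM2l ?ler0n // -subr_ge0.
have -> : 'C(n - k, r)%:R * (alpha * ln n%:R / n%:R ^+ r) -
    ln n%:R * (alpha * c ^+ r / r`!%:R) =
    alpha * ln n%:R / n%:R ^+ r / r`!%:R *
    ('C(n - k, r)%:R * r`!%:R - (c * n%:R) ^+ r).
  by rewrite exprMn; field; rewrite !gt_eqF.
apply: mulr_ge0; last by rewrite subr_ge0.
by rewrite !mulr_ge0 ?invr_ge0 // ltW.
Qed.

(** Here mu^(r+1) = eta (n/k)^r, the choice that makes the exponent from the simplexes inside at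
    most k alpha eta ln n, linear in k. As k <= eta n and r >= 1, t is nonnegative, so mu >= 1. *)
Lemma small_detached_term_le (R : realType) (n k r : nat) (alpha p eta eps : R)
    (t := (r%:R * (ln n%:R - ln k%:R) + ln eta) / r.+1%:R) :
  (0 < r)%N -> 0 < alpha -> 0 <= p <= 1 -> p = alpha * ln n%:R / n%:R ^+ r ->
  0 < eta -> eta <= 1 -> 0 < eps -> eps <= eta -> 2 * eps <= 1 ->
  (0 < n)%N -> (0 < k)%N -> r%:R <= eps * n%:R -> k%:R <= eps * n%:R ->
  0 <= t /\
  'C(n, k)%:R * ((expR t)^-1 ^+ k *
    ((1 + p * (expR t ^+ r.+1 - 1)) ^+ 'C(k, r.+1) *
     (1 - p) ^+ (k * 'C(n - k, r)))) <=
  expR (1 - ln eta + ln n%:R *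
    (r.+1%:R^-1 + alpha * eta - alpha * (1 - 2 * eps) ^+ r / r`!%:R)) ^+ k.
Proof.
move=> r0 a0 p01 pE eta0 eta1 eps0 epseta eps2 n0 k0 rn kn.
have n0R : 0 < n%:R :> R by rewrite ltr0n.
have k0R : 0 < k%:R :> R by rewrite ltr0n.
have r0R : 1 <= r%:R :> R by rewrite ler1n.
have L0 : 0 <= ln n%:R :> R by rewrite ln_ge0 // ler1n.
have l0 : 0 <= ln k%:R :> R by rewrite ln_ge0 // ler1n.
have leta : ln eta <= 0 by rewrite ln_le0.
have lk : ln k%:R <= ln eta + ln n%:R :> R.
  rewrite -lnM ?posrE // ler_ln ?posrE ?mulr_gt0 //.
  by rewrite (le_trans kn) // ler_wpM2r // ltW.
have d0 : 0 < r.+1%:R :> R by rewrite ltr0n.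
have t0 : 0 <= t.
  by rewrite /t divr_ge0 ?(ltW d0) //; nra.
split => //; apply: le_trans (detached_term_le _ _ _ _ _ _ _ _ p01 t0 k0 n0) _.
rewrite -expRM_natl ler_expR.
have cw : k%:R * (ln n%:R * (alpha * (1 - 2 * eps) ^+ r / r`!%:R)) <=
    (k * 'C(n - k, r))%:R * p.
  by rewrite pE; apply: crossing_weight_ge => //; lra.
have dt : r.+1%:R * t = r%:R * (ln n%:R - ln k%:R) + ln eta.
  by rewrite /t mulrC divfK // gt_eqF.
have Nw : 'C(k, r.+1)%:R * p * (expR (r.+1%:R * t) - 1) <=
    k%:R * (ln n%:R * (alpha * eta)).
  have p0 : 0 <= p by case/andP: p01.
  apply: (@le_trans _ _ (k%:R ^+ r.+1 * p * expR (r.+1%:R * t))).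
    apply: ler_pM; rewrite ?mulr_ge0 ?ler0n ?subr_ge0 //.
    - by rewrite -expR0 ler_expR mulr_ge0 // ltW.
    - by rewrite ler_wpM2r // bin_le_exp.
    - by rewrite gerBl.
  rewrite dt expRD expRM_natl expRD expRN !lnK ?posrE // pE exprMn exprVn exprS.
  rewrite le_eqVlt; apply/orP; left; apply/eqP.
  by field; rewrite !expf_neq0 ?gt_eqF.
(* Up to constants, C(n,k) mu^-k contributes (n/k)^(k/(r+1)) <= n^(k/(r+1)). *)
have tk : k%:R * (1 + ln n%:R - ln k%:R - t) <=
    k%:R * (1 - ln eta + ln n%:R * r.+1%:R^-1).
  apply: ler_wpM2l; first exact: ltW.
  have -> : t = ln n%:R - ln k%:R - (ln n%:R - ln k%:R - ln eta) / r.+1%:R.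
    by rewrite /t -natr1; field; rewrite natr1 gt_eqF.
  have i1 : r.+1%:R^-1 <= 1 :> R by rewrite invf_le1 // ler1n.
  have i0 : 0 <= r.+1%:R^-1 :> R by rewrite invr_ge0 ltW.
  have := mulr_ge0 l0 i0; have : 0 <= - ln eta * (1 - r.+1%:R^-1).
    by rewrite mulr_ge0 ?oppr_ge0 ?subr_ge0.
  by move: (r.+1%:R^-1) => i; nra.
rewrite [leRHS](_ : _ = k%:R * (1 - ln eta + ln n%:R * r.+1%:R^-1) +
  k%:R * (ln n%:R * (alpha * eta)) -
  k%:R * (ln n%:R * (alpha * (1 - 2 * eps) ^+ r / r`!%:R))); last by ring.
exact: lerB (lerD tk Nw) cw.
Qed.

(** With mu = 1 covering is ignored: C(n,k) <= (e / eps)^k, and the crossing factor alone wins. From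
    k <= n / 2 and r <= n / 4 comes the constant 1 / 4. *)
Lemma large_detached_term_le (R : realType) (n k r : nat) (alpha p eps : R) :
  0 < alpha -> 0 <= p <= 1 -> p = alpha * ln n%:R / n%:R ^+ r ->
  0 < eps -> (0 < n)%N -> (0 < k)%N -> r%:R <= 4^-1 * n%:R :> R ->
  eps * n%:R < k%:R -> (2 * k <= n)%N ->
  'C(n, k)%:R * (1^-1 ^+ k *
    ((1 + p * (1 ^+ r.+1 - 1)) ^+ 'C(k, r.+1) *
     (1 - p) ^+ (k * 'C(n - k, r)))) <=
  expR (1 - ln eps - ln n%:R * (alpha * 4^-1 ^+ r / r`!%:R)) ^+ k.
Proof.
move=> a0 p01 pE eps0 n0 k0 rn kn k2.
have n0R : 0 < n%:R :> R by rewrite ltr0n.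
have k0R : 0 < k%:R :> R by rewrite ltr0n.
have := detached_term_le R n k 'C(k, r.+1) (k * 'C(n - k, r)) r.+1 p 0
  p01 (lexx 0) k0 n0.
rewrite !expR0 mulr0 expR0 subrr mulr0 addr0 subr0 => /le_trans; apply.
rewrite -expRM_natl ler_expR.
have k2R : 2 * k%:R <= n%:R :> R by rewrite -natrM ler_nat.
have cw : k%:R * (ln n%:R * (alpha * 4^-1 ^+ r / r`!%:R)) <=
    (k * 'C(n - k, r))%:R * p.
  by rewrite pE; apply: crossing_weight_ge => //; lra.
have lk : ln eps + ln n%:R <= ln k%:R :> R.
  by rewrite -lnM ?posrE // ler_ln ?posrE ?mulr_gt0 // ltW.
by rewrite [leRHS]mulrBr; apply: lerB => //; rewrite ler_wpM2l ?(ltW k0R) //; lra.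
Qed.

Lemma expected_simplices_ge (R : realType) (n r : nat) (alpha : R) :
  0 < alpha -> (2 * r.+1 <= n)%N ->
  alpha / (2 ^+ r.+1 * r.+1`!%:R) * (n%:R * ln n%:R) <=
  'C(n, r.+1)%:R * (alpha * ln n%:R / n%:R ^+ r).
Proof.
move=> a0 rn; have n0 : (0 < n)%N by lia.
have n0R : 0 < n%:R :> R by rewrite ltr0n.
have L0 : 0 <= ln n%:R :> R by rewrite ln_ge0 // ler1n.
have f0 : 0 < r.+1`!%:R :> R by rewrite ltr0n fact_gt0.
have rnR : 2 * r.+1%:R <= n%:R :> R by rewrite -natrM ler_nat.
have h : (n%:R / 2) ^+ r.+1 <= 'C(n, r.+1)%:R * r.+1`!%:R :> R.
  by apply: exp_le_bin_fact; lra.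
rewrite -subr_ge0.
have -> : 'C(n, r.+1)%:R * (alpha * ln n%:R / n%:R ^+ r) -
   alpha / (2 ^+ r.+1 * r.+1`!%:R) * (n%:R * ln n%:R) =
   alpha * ln n%:R / n%:R ^+ r / r.+1`!%:R *
   ('C(n, r.+1)%:R * r.+1`!%:R - (n%:R / 2) ^+ r.+1).
  rewrite exprMn exprVn [n%:R ^+ r.+1]exprS.
  by field; rewrite !expf_neq0 ?gt_eqF.
apply: mulr_ge0; last by rewrite subr_ge0.
by rewrite !mulr_ge0 ?invr_ge0 ?exprn_ge0 // ltW.
Qed.

(** * Supercritical case *)

Lemma bernoulli_onem (R : realFieldType) (x : R) (r : nat) :
  0 <= x -> x <= 1 -> 1 - r%:R * x <= (1 - x) ^+ r.
Proof.
move=> x0 x1; elim: r => [|r IH]; first by rewrite mul0r subr0 expr0.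
have q0 : 0 <= 1 - x by rewrite subr_ge0.
rewrite exprS; apply: le_trans (ler_wpM2l q0 IH).
have := mulr_ge0 (ler0n R r) (mulr_ge0 x0 x0).
by rewrite -natr1; nra.
Qed.

Lemma Pr_not_unique_small (R : realType) (r : nat) (alpha : R)
    (p : nat -> R) (e : R) :
  (0 < r)%N -> 0 < alpha -> (forall n, 0 <= p n <= 1) ->
  (\forall n \near \oo%classic, p n = alpha * ln n%:R / n%:R ^+ r) ->
  r`!%:R / r.+1%:R < alpha -> 0 < e ->
  \forall n \near \oo%classic,
    Pr r (p n) (fun S : {set {set 'I_n}} => ~~ unique_nonisolated_component S)
      <= e.
Proof.
move=> r0 a0 p01 pE ar e0.
have f0 : 0 < r`!%:R :> R by rewrite ltr0n fact_gt0.
have f1 : 1 <= r`!%:R :> R by rewrite ler1n fact_gt0.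
have fS0 : 0 < r.+1`!%:R :> R by rewrite ltr0n fact_gt0.
have r0R : 0 < r%:R :> R by rewrite ltr0n.
have r1R : 1 <= r%:R :> R by rewrite ler1n.
have d0 : 0 < r.+1%:R :> R by rewrite ltr0n.
(* The gap to the threshold. [eta] and [eps] are small enough that both losses in [rate], alpha eta
   and the one from (1 - 2 eps)^r >= 1 - eta, are at most dlt / 4. *)
pose dlt := alpha / r`!%:R - r.+1%:R^-1.
have dlt0 : 0 < dlt.
  by rewrite subr_gt0 ltr_pdivlMr // mulrC.
pose eta := Num.min 1 (dlt / (4 * alpha)).
have eta0 : 0 < eta by rewrite lt_min ltr01 divr_gt0 // mulr_gt0.
have eta1 : eta <= 1 by rewrite ge_min lexx.
have etad : alpha * eta <= dlt / 4.
  have : eta <= dlt / (4 * alpha) by rewrite ge_min lexx orbT.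
  by rewrite ler_pdivlMr ?mulr_gt0 // => h; lra.
pose eps := eta / (2 * r%:R).
have eps0 : 0 < eps by rewrite divr_gt0 // mulr_gt0.
have epsr : 2 * eps * r%:R = eta by rewrite /eps; field; rewrite gt_eqF.
have eps2 : 2 * eps <= eta by nra.
have rate : r.+1%:R^-1 + alpha * eta - alpha * (1 - 2 * eps) ^+ r / r`!%:R
    <= - (dlt / 2).
  have hb : 1 - r%:R * (2 * eps) <= (1 - 2 * eps) ^+ r.
    by apply: bernoulli_onem; lra.
  have af : alpha / r`!%:R <= alpha by rewrite ler_pdivrMr // ler_peMr // ltW.
  have af0 : 0 <= alpha / r`!%:R by rewrite divr_ge0 // ltW.
  have h1 : alpha / r`!%:R * (1 - eta) <= alpha / r`!%:R * (1 - 2 * eps) ^+ r.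
    by rewrite ler_wpM2l //; lra.
  have h2 : alpha / r`!%:R * eta <= alpha * eta by rewrite ler_wpM2r // ltW.
  have h3 : alpha / r`!%:R = dlt + r.+1%:R^-1 by rewrite /dlt subrK.
  rewrite [alpha * _ ^+ r / _]mulrAC.
  move: (alpha / r`!%:R) (r.+1%:R^-1) ((1 - 2 * eps) ^+ r) h1 h2 h3 => A i X.
  by lra.
pose c := alpha * 4^-1 ^+ r / r`!%:R.
have c0 : 0 < c by rewrite divr_gt0 // mulr_gt0 // exprn_gt0.
(* [g] and [K] serve small and large k alike; for small k, eps <= eta gives 1 - ln eta <= K. *)
pose g := Num.min (dlt / 2) c.
have g0 : 0 < g by rewrite lt_min c0 divr_gt0.
pose K := 1 - ln eps.
pose c2 := alpha / (2 ^+ r.+1 * r.+1`!%:R).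
have c20 : 0 < c2 by rewrite divr_gt0 // mulr_gt0 // exprn_gt0.
(* A ratio below 1 / 2 makes the geometric sum at most twice the ratio, here at most e / 2. *)
pose z := Num.min 2^-1 (e / 4).
have z0 : 0 < z by rewrite lt_min invr_gt0 ltr0n divr_gt0.
near=> n.
have pnE : p n = alpha * ln n%:R / n%:R ^+ r by near: n.
have n0 : (0 < n)%N by near: n; exact: nbhs_infty_ge.
have nr : (2 * r.+1 <= n)%N by near: n; exact: nbhs_infty_ge.
have n4 : r%:R <= 4^-1 * n%:R :> R.
  have : r%:R * 4 <= n%:R :> R by near: n; exact: nbhs_infty_ger.
  lra.
have neps : r%:R <= eps * n%:R.
  rewrite mulrC -ler_pdivrMr //.
  by near: n; exact: nbhs_infty_ger.
have L1 : (K - ln z) / g <= ln n%:R by near: n; exact: near_le_ln.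
have L2 : - ln (e / 2) / c2 <= ln n%:R by near: n; exact: near_le_ln.
have n0R : 0 < n%:R :> R by rewrite ltr0n.
have n1R : 1 <= n%:R :> R by rewrite ler1n.
have L0 : 0 <= ln n%:R :> R by rewrite ln_ge0.
pose x := expR (K - ln n%:R * g).
have xz : x <= z.
  move: L1; rewrite ler_pdivrMr // => L1.
  by rewrite -[leRHS]lnK ?posrE // ler_expR; lra.
pose mu k := if (k%:R : R) <= eps * n%:R
  then expR ((r%:R * (ln n%:R - ln k%:R) + ln eta) / r.+1%:R) else 1.
have term k : (0 < k)%N -> (2 * k <= n)%N ->
  'C(n, k)%:R * ((mu k)^-1 ^+ k * ((1 + p n * (mu k ^+ r.+1 - 1)) ^+ 'C(k, r.+1) *
                   (1 - p n) ^+ (k * 'C(n - k, r)))) <= x ^+ k.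
  move=> k0 k2; rewrite /mu; case: ifPn => [kn|].
    have epse : eps <= eta by lra.
    have eps1 : 2 * eps <= 1 by lra.
    have [_ /le_trans] := small_detached_term_le R n k r alpha (p n) eta eps
      r0 a0 (p01 n) pnE eta0 eta1 eps0 epse eps1 n0 k0 neps kn.
    apply; rewrite lerXn2r ?nnegrE ?expR_ge0 // ler_expR; apply: lerD.
      by rewrite lerD2l lerN2 ler_ln.
    rewrite -[leRHS]mulrN ler_wpM2l // (le_trans rate) // lerN2.
    by rewrite ge_min lexx.
  rewrite -ltNge => kn.
  apply: le_trans (large_detached_term_le R n k r alpha (p n) eps
    a0 (p01 n) pnE eps0 n0 k0 n4 kn k2) _.
  rewrite lerXn2r ?nnegrE ?expR_ge0 // ler_expR lerD2l lerN2 ler_wpM2l //.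
  by rewrite ge_min lexx orbT.
have mu1 k : (0 < k)%N -> 1 <= mu k.
  move=> k0; rewrite /mu; case: ifPn => // kn.
  have epse : eps <= eta by lra.
  have eps1 : 2 * eps <= 1 by lra.
  have [t0 _] := small_detached_term_le R n k r alpha (p n) eta eps
      r0 a0 (p01 n) pnE eta0 eta1 eps0 epse eps1 n0 k0 neps kn.
  by rewrite -[leLHS]expR0 ler_expR.
apply: le_trans (Pr_not_unique_le R n r (p n) mu r0 (p01 n) mu1) _.
have -> : e = e / 2 + 2 * (e / 4) by field.
apply: lerD.
  (* Nothing is selected with probability at most exp of minus the mean number of simplexes, which
     is at least c2 n ln n. *)
  apply: le_trans (onem_exp_le _ _ _ _) _; first by case/andP: (p01 n).
  rewrite -[leRHS]lnK ?posrE ?divr_gt0 // ler_expR pnE.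
  have := expected_simplices_ge R n r alpha a0 nr; rewrite -/c2.
  move: L2; rewrite ler_pdivrMr // => L2.
  have : c2 * ln n%:R <= c2 * (n%:R * ln n%:R).
    by rewrite ler_wpM2l ?(ltW c20) // ler_peMl.
  by lra.
apply: (@le_trans _ _ (2 * x)); last first.
  by rewrite ler_wpM2l // (le_trans xz) // ge_min lexx orbT.
apply: (@le_trans _ _ (\sum_(k < n.+1 | (0 < k)%N && (2 * k <= n)%N) x ^+ k)).
  by apply: ler_sum => k /andP[k0 k2]; apply: term.
apply: (sum_exp_le _ n (fun k => (2 * k <= n)%N)); first exact: expR_ge0.
by rewrite (le_trans xz) // ge_min lexx.
Unshelve. all: by end_near.
Qed.

(** * Subcritical case *)

(** For m >= 2, m^2 <= 4 (m - 1)^2; then 4 m and 4 y m^2 are each at most e m^2 / 2. *)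
Lemma second_moment_small (R : realFieldType) (m y e P : R) :
  2 <= m -> 0 <= P -> 8 <= e * m -> y <= e / 8 ->
  P * (m - 1) ^+ 2 <= m + y * m ^+ 2 -> P <= e.
Proof.
move=> m2 P0 em ye hP.
have mm0 : 0 < m ^+ 2 by rewrite exprn_gt0 //; lra.
have h0 : m ^+ 2 <= 4 * (m - 1) ^+ 2.
  rewrite -subr_ge0 [X in 0 <= X](_ : _ = (m - 2) * (3 * m - 2)); last by ring.
  by rewrite mulr_ge0 //; lra.
have h1 := ler_wpM2l P0 h0.
have h2 : y * m ^+ 2 <= e / 8 * m ^+ 2 by rewrite ler_wpM2r // ltW.
have h3 : 8 * m <= e * m ^+ 2 by rewrite expr2 mulrA ler_wpM2r //; lra.
by rewrite -(ler_pM2r mm0); lra.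
Qed.

Lemma Pr_unique_small (R : realType) (r : nat) (alpha : R)
    (p : nat -> R) (e : R) :
  (0 < r)%N -> 0 < alpha -> (forall n, 0 <= p n <= 1) ->
  (\forall n \near \oo%classic, p n = alpha * ln n%:R / n%:R ^+ r) ->
  alpha < r`!%:R / r.+1%:R -> 0 < e ->
  \forall n \near \oo%classic,
    Pr r (p n) (fun S : {set {set 'I_n}} => unique_nonisolated_component S)
      <= e.
Proof.
move=> r0 a0 p01 pE ar e0.
have f0 : 0 < r`!%:R :> R by rewrite ltr0n fact_gt0.
have fS0 : 0 < r.+1`!%:R :> R by rewrite ltr0n fact_gt0.
have d0 : 0 < r.+1%:R :> R by rewrite ltr0n.
have d1 : 1 <= r.+1%:R :> R by rewrite ler1n.
(* A given simplex meets about beta ln n / p others, so it is isolated, once selected, with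
   probability about n^-beta. The slack [kap] pays for replacing 1 - p by exp (- p kap), and beta
   kap = (1 + beta) / 2 is still below 1. *)
pose beta := alpha * r.+1%:R / r`!%:R.
have beta0 : 0 < beta by rewrite divr_gt0 // mulr_gt0.
have beta1 : beta < 1.
  by rewrite ltr_pdivrMr // mul1r -ltr_pdivlMr.
pose kap := (1 + beta) / (2 * beta).
have kap1 : 1 < kap by rewrite ltr_pdivlMr ?mulr_gt0 //; lra.
have kap0 : 0 < kap by lra.
have kapV : kap^-1 < 1 by rewrite invf_lt1.
have le0 : 0 < ln (1 + e / 8) by rewrite ln_gt0 // ltrDl divr_gt0.
(* A bound for p and for the correlation exponent: it yields 1 / b <= 1 + e / 8, p <= 1 / 2 and 1 /
   (1 - p) <= kap. *)
pose w := Num.min (ln (1 + e / 8)) (Num.min 2^-1 (1 - kap^-1)).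
have w0 : 0 < w by rewrite !lt_min le0 invr_gt0 ltr0n subr_gt0.
pose c1 : R := 2 * r.+1%:R ^+ 2 * alpha.
have c10 : 0 < c1 by rewrite !mulr_gt0 ?exprn_gt0.
pose c2 := alpha / (2 ^+ r.+1 * r.+1`!%:R).
have c20 : 0 < c2 by rewrite divr_gt0 // mulr_gt0 // exprn_gt0.
pose M := Num.max 2 (8 / e).
have M0 : 0 < M by rewrite lt_max ltr0n.
near=> n.
have pnE : p n = alpha * ln n%:R / n%:R ^+ r by near: n.
have n0 : (0 < n)%N by near: n; exact: nbhs_infty_ge.
have nr : (2 * r.+1 <= n)%N by near: n; exact: nbhs_infty_ge.
have L1 : 1 <= ln n%:R :> R by near: n; exact: near_le_ln.
have L2 : (ln M - ln c2) / ((1 - beta) / 2) <= ln n%:R.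
  by near: n; exact: near_le_ln.
have Ln : ln n%:R <= w / c1 * n%:R.
  by near: n; apply: near_ln_le; rewrite divr_gt0.
have n0R : 0 < n%:R :> R by rewrite ltr0n.
have n1R : 1 <= n%:R :> R by rewrite ler1n.
have L0 : 0 <= ln n%:R :> R by rewrite ln_ge0.
have nX0 : 0 < n%:R ^+ r :> R by rewrite exprn_gt0.
have Lw : c1 * (ln n%:R / n%:R) <= w.
  rewrite mulrA ler_pdivrMr // mulrC -ler_pdivlMr // mulrAC.
  exact: Ln.
have p0 : 0 <= p n by case/andP: (p01 n).
have Bp : (r.+1 ^ 2 * 'C(n, r.-1))%:R * (p n * 2) <= w.
  apply: le_trans Lw; rewrite natrM natrX.
  have := bin_le_exp R n r.-1 => hb.
  apply: (@le_trans _ _ (r.+1%:R ^+ 2 * n%:R ^+ r.-1 * (p n * 2))).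
    by rewrite ler_wpM2r ?mulr_ge0 // ler_wpM2l // exprn_ge0.
  have nrE : n%:R ^+ r = n%:R * n%:R ^+ r.-1 :> R by rewrite -exprS prednK.
  rewrite pnE nrE /c1 le_eqVlt; apply/orP; left; apply/eqP.
  by field; rewrite expf_neq0 ?gt_eqF.
have pw : p n <= w.
  apply: le_trans Bp; rewrite mulrCA ler_peMr // -natrM ler1n !muln_gt0 /=.
  rewrite bin_gt0 ?andbT (leq_trans (leq_pred r)) //.
  by move: nr; clear; lia.
have pK : p n <= 1 - kap^-1 by rewrite (le_trans pw) // !ge_min lexx !orbT.
have p2 : p n <= 2^-1 by rewrite (le_trans pw) // !ge_min lexx !orbT.
have p1 : p n < 1 by lra.
have q0 : 0 < 1 - p n by lra.
pose m := \sum_(s in r_simplices n r) p n * (1 - p n) ^+ #|meeting n r s|.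
have mM : M <= m.
  have Dp : (r.+1 * 'C(n, r))%:R * (p n * kap) <= (1 + beta) / 2 * ln n%:R.
    have -> : (1 + beta) / 2 = beta * kap.
      by rewrite /kap; field; rewrite gt_eqF.
    rewrite -mulrA [leRHS]mulrCA mulrA [leLHS]mulrC.
    rewrite ler_wpM2l ?(ltW kap0) // natrM pnE -subr_ge0.
    have -> : beta * ln n%:R - r.+1%:R * 'C(n, r)%:R *
        (alpha * ln n%:R / n%:R ^+ r) =
        r.+1%:R * alpha * ln n%:R / n%:R ^+ r / r`!%:R *
        (n%:R ^+ r - 'C(n, r)%:R * r`!%:R).
      by rewrite /beta; field; rewrite !gt_eqF.
    by rewrite !mulr_ge0 ?invr_ge0 ?subr_ge0 ?bin_fact_le // ltW.
  apply: (@le_trans _ _ (\sum_(s in r_simplices n r)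
      p n * expR (- ((1 + beta) / 2 * ln n%:R)))); last first.
    apply: ler_sum => s sU; apply: ler_wpM2l => //.
    apply: (@le_trans _ _ ((1 - p n) ^+ (r.+1 * 'C(n, r)))).
      apply: le_trans (le_onem_exp R (p n) kap (r.+1 * 'C(n, r)) p0 p1 _).
        by rewrite ler_expR lerN2.
      by rewrite invf_ple ?posrE //; lra.
    apply: ler_wiXn2l; rewrite ?(ltW q0) ?gerBl //.
    exact: card_meeting.
  rewrite sumr_const card_r_simplices -[_ *+ _]mulr_natl mulrA.
  (* Dropping ln n >= 1 leaves c2 n^((1 - beta) / 2), which [L2] makes at least M. *)
  apply: (@le_trans _ _ (c2 * n%:R * expR (- ((1 + beta) / 2 * ln n%:R)))).
    rewrite -[X in c2 * X](lnK (n0R : n%:R \in Num.pos)).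
    rewrite -mulrA -expRD -[X in X * _](lnK (c20 : c2 \in Num.pos)) -expRD.
    rewrite -[leLHS]lnK ?posrE // ler_expR.
    move: L2; rewrite ler_pdivrMr; first by lra.
    by rewrite divr_gt0 // subr_gt0.
  apply: ler_wpM2r; first exact: expR_ge0.
  rewrite pnE; apply: le_trans (expected_simplices_ge R n r alpha a0 nr).
  by rewrite ler_wpM2l ?(ltW c20) // ler_peMr // ltW.
have m2 : 2 <= m by apply: le_trans mM; rewrite le_max lexx.
have m1 : 1 <= m by lra.
have := Pr_unique_le R n r (p n) r0 p0 p1 m1; rewrite -/m.
set P := Pr _ _ _; set b := _ ^+ (r.+1 ^ 2 * _) => hP.
have bV : b^-1 - 1 <= e / 8.
  rewrite lerBlDl -[leRHS]lnK ?posrE ?addr_gt0 ?divr_gt0 //.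
  rewrite invf_ple ?posrE ?expR_gt0 ?exprn_gt0 // -expRN.
  apply: le_trans (le_onem_exp R (p n) 2 _ p0 p1 _).
    by rewrite ler_expR lerN2 (le_trans Bp) // ge_min lexx.
  by rewrite invf_ple ?posrE //; lra.
have em : 8 <= e * m.
  rewrite mulrC -ler_pdivrMr //; apply: le_trans mM.
  by rewrite le_max lexx orbT.
have P0 : 0 <= P.
  by rewrite /P PrE; apply: expect_ge0 => // S _; rewrite ler0n.
exact: (second_moment_small _ _ _ _ _ m2 P0 em bV hP).
Unshelve. all: by end_near.
Qed.

Local Open Scope classical_set_scope.

(** The formula for [p] is imposed only for large n, since its value may exceed 1 for small n. *)
Theorem theorem5p2 (R : realType) (r : nat) (hr : (1 <= r)%N)
    (alpha : R) (halpha : 0 < alpha)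
    (p : nat -> R) (hp01 : forall n : nat, 0 <= p n <= 1)
    (hp : \forall n \near \oo, p n = alpha * ln n%:R / n%:R ^+ r) :
  (r`!%:R / r.+1%:R < alpha ->
     Pr r (p n) (fun S : {set {set 'I_n}} => unique_nonisolated_component S)
       @[n --> \oo] --> (1 : R)) /\
  (alpha < r`!%:R / r.+1%:R ->
     Pr r (p n) (fun S : {set {set 'I_n}} => ~~ unique_nonisolated_component S)
       @[n --> \oo] --> (1 : R)).
Proof.
have Pr_ge0 n (A : pred {set {set 'I_n}}) : 0 <= Pr r (p n) A.
  by rewrite PrE; apply: expect_ge0 => // S _; rewrite ler0n.
split=> ha; apply/cvgrPdist_le => e e0; near=> n.
  rewrite PrC subKr ger0_norm //; near: n.
  exact: (Pr_not_unique_small R r alpha).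
have -> : 1 - Pr r (p n) (fun S : {set {set 'I_n}} =>
    ~~ unique_nonisolated_component S) =
    Pr r (p n) (fun S : {set {set 'I_n}} => unique_nonisolated_component S).
  by rewrite [RHS]PrC.
rewrite ger0_norm //; near: n.
exact: (Pr_unique_small R r alpha).
Unshelve. all: by end_near.
Qed.
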